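(* Let $S$ be a semigroup, let $T$ be a subsemigroup of $S$ generated by a set $B$, and let $H$ be an arbitrary $T$-relative $\mathscr{H}$-class of $S$ (possibly contained in $T$). Let $\{H_\lambda:\lambda\in\Lambda\}$ be the collection of all $T$-relative $\mathscr{H}$-classes in the $T$-relative $\mathscr{R}$-class of $H$, and let $p_\lambda,p_\lambda'\in T^1$ $(\lambda\in\Lambda)$ and the action $(\lambda,t)\mapsto\lambda\cdot t$ of $T^1$ on $\Lambda\cup\{0\}$ be as defined in the context. Then the relative Schützenberger group $\Gamma=\Gamma(H)$ of $H$ is a group generated by \[ X=\{(p_\lambda\, b\, p'_{\lambda\cdot b})/\gamma : \lambda\in\Lambda,\ b\in B,\ \lambda\cdot b\neq 0\}. \] In particular, if $T$ is finitely generated, and the relative $\mathscr{R}$-class of $H$ contains only finitely many relative $\mathscr{H}$-classes, then $\Gamma$ is finitely generated.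
   Context: For a semigroup $S$, $S^1=S\cup\{1\}$ denotes $S$ with a new identity element $1\notin S$ adjoined; for $X\subseteq S$, $X^1=X\cup\{1\}$. For a subsemigroup $T$ of $S$ and $u,v\in S$: $u\,\mathscr{R}^T v$ iff $uT^1=vT^1$; $u\,\mathscr{L}^T v$ iff $T^1u=T^1v$; $\mathscr{H}^T=\mathscr{R}^T\cap\mathscr{L}^T$. Their classes are the $T$-relative $\mathscr{R}$-, $\mathscr{L}$- and $\mathscr{H}$-classes. For a $T$-relative $\mathscr{H}$-class $H$, let $\mathrm{Stab}(H)=\{t\in T^1: Ht=H\}$ and let $\gamma=\gamma(H)$ be the congruence on $\mathrm{Stab}(H)$ given by $(x,y)\in\gamma$ iff $hx=hy$ for all $h\in H$. The quotient $\Gamma(H)=\mathrm{Stab}(H)/\gamma$ is a group, called the ($T$-)relative Schützenberger group of $H$; $x/\gamma$ denotes the $\gamma$-class of $x$. The elements $p_\lambda,p_\lambda'\in T^1$ $(\lambda\in\Lambda)$ are chosen (this is always possible) such that $Hp_\lambda=H_\lambda$, $h_1p_\lambda p_\lambda'=h_1$ for all $h_1\in H$, and $h_2p_\lambda'p_\lambda=h_2$ for all $h_2\in H_\lambda$. The set $\Lambda$ contains a distinguished element $\lambda_1$ with $H_{\lambda_1}=H$ and $p_{\lambda_1}=p_{\lambda_1}'=1$. The action of $T^1$ on $\Lambda\cup\{0\}$ is: $\lambda\cdot t=\mu$ if $\lambda,\mu\in\Lambda$ and $H_\lambda t=H_\mu$; and $\lambda\cdot t=0$ otherwise. *)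

(* Defs.v *)
From HB Require Import structures.
From mathcomp Require Import all_boot all_classical.
From mathcomp Require Export monoid.

Set Implicit Arguments.
Unset Strict Implicit.
Unset Printing Implicit Defensive.

Local Open Scope classical_set_scope.
Local Open Scope group_scope.
Local Open Scope quotient_scope.

(* S^1 : None is the new identity, adjoined even when S already has one. *)
Definition adj1 (S : Type) : Type := option S.

Section Adjoin.
Variable S : semigroupType.

Definition inS (s : S) : adj1 S := Some s.

Definition adj1_mul (x y : adj1 S) : adj1 S :=
  match x, y with
  | Some a, Some b => Some (a * b)
  | Some a, None => Some a
  | None, _ => y
  end.

Fact adj1_mulA : associative adj1_mul.
Proof. by move=> [a|] [b|] [c|] //=; rewrite mulgA. Qed.
Fact adj1_mul1 : left_id None adj1_mul. Proof. by []. Qed.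
Fact adj1_1mul : right_id None adj1_mul. Proof. by case. Qed.

HB.instance Definition _ := Choice.on (adj1 S).
HB.instance Definition _ :=
  isMonoid.Build (adj1 S) adj1_mulA adj1_mul1 adj1_1mul.

(* For u in S and t in S^1 the products u t and t u, taken in S^1, lie in S. *)
Definition ract (u : S) (t : adj1 S) : S := if t is Some a then u * a else u.
Definition lact (t : adj1 S) (u : S) : S := if t is Some a then a * u else u.

Lemma inS_ract u t : inS (ract u t) = inS u * t. Proof. by case: t. Qed.
Lemma inS_lact t u : inS (lact t u) = t * inS u. Proof. by case: t. Qed.

End Adjoin.

Notation "u *> t" := (ract u t) (at level 40, left associativity).
Notation "t *< u" := (lact t u) (at level 40, left associativity).

Definition semigroup_closure (S : semigroupType) (B : set S) : set S :=
  smallest (fun T : set S => mulg_closed [in T]) B.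

Definition group_closure (G : groupType) (X : set G) : set G :=
  smallest (fun K : set G => group_closed [in K]) X.

Section Relative.
Variables (S : semigroupType) (T : set S).
Implicit Types (H : set S) (u v : S).

(* T^1 *)
Definition adj1_set : set (adj1 S) := [set t | t = 1 \/ exists2 s, T s & t = inS s].

Definition relR u v : Prop :=
  [set u *> t | t in adj1_set] = [set v *> t | t in adj1_set].
Definition relL u v : Prop :=
  [set t *< u | t in adj1_set] = [set t *< v | t in adj1_set].
Definition relH u v : Prop := relR u v /\ relL u v.

Definition is_Hclass H : Prop := exists h, H = [set u | relH h u].

(* The relative R-class containing the relative H-class H. *)
Definition Rclass_of H : set S := [set u | exists2 h, H h & relR h u].

Definition Hclasses_in_Rclass H : set (set S) :=
  [set K | is_Hclass K /\ K `<=` Rclass_of H].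

Definition Stab H : set (adj1 S) :=
  [set t | adj1_set t /\ [set h *> t | h in H] = H].

Definition gamma H (x y : Stab H) : bool :=
  `[< forall h, H h -> h *> val x = h *> val y >].

Lemma gamma_refl H : reflexive (@gamma H).
Proof. by move=> x; apply/asboolP. Qed.

Lemma gamma_sym H : symmetric (@gamma H).
Proof. by move=> x y; apply/asboolP/asboolP => E h Hh; rewrite E. Qed.

Lemma gamma_trans H : transitive (@gamma H).
Proof.
by move=> y x z /asboolP xy /asboolP yz; apply/asboolP => h Hh; rewrite xy ?yz.
Qed.

Canonical gamma_equiv H :=
  EquivRel (@gamma H) (@gamma_refl H) (@gamma_sym H) (@gamma_trans H).

End Relative.

(* Gamma(H); the two hypotheses are what makes the quotient a group. *)
Definition Schutz (S : semigroupType) (T H : set S)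
    (hT : mulg_closed [in T]) (hH : is_Hclass T H) : Type :=
  {eq_quot @gamma_equiv S T H}.

Section SchutzGroup.
Variables (S : semigroupType) (T H : set S).
Hypotheses (hT : mulg_closed [in T]) (hH : is_Hclass T H).

Notation G := (Schutz hT hH).

HB.instance Definition _ := Choice.on G.
HB.instance Definition _ := EqQuotient.on G.

(* x / gamma *)
Definition schutz_class (x : Stab T H) : G := \pi_G x.

Lemma schutz_classP (x y : Stab T H) :
  schutz_class x = schutz_class y <-> forall h, H h -> h *> val x = h *> val y.
Proof.
split=> [/eqquotP/asboolP //|E]; exact/eqquotP/asboolP.
Qed.

Lemma ractM (u : S) (x y : adj1 S) : u *> (x * y) = u *> x *> y.
Proof. by case: x y => [a|] [b|] //=; rewrite mulgA. Qed.

Lemma lract (x y : adj1 S) (u : S) : (x *< u) *> y = x *< (u *> y).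
Proof. by case: x y => [a|] [b|] //=; rewrite mulgA. Qed.

Lemma adj1_set1 : adj1_set T 1. Proof. by left. Qed.

Lemma adj1_setM x y : adj1_set T x -> adj1_set T y -> adj1_set T (x * y).
Proof.
case=> [->|[a Ta ->]]; first by rewrite mul1g.
case=> [->|[b Tb ->]]; first by rewrite mulg1; right; exists a.
by right; exists (a * b) => //; apply/set_mem/hT; apply/mem_set.
Qed.

Lemma Stab1 : Stab T H 1.
Proof.
split; first exact: adj1_set1.
by apply/seteqP; split=> [_ [h Hh <-]|h Hh] //; exists h.
Qed.

Lemma StabM x y : Stab T H x -> Stab T H y -> Stab T H (x * y).
Proof.
move=> [Tx Hx] [Ty Hy]; split; first exact: adj1_setM.
apply/seteqP; split=> [_ [h Hh <-]|h].
  rewrite ractM -[X in X _]Hy; exists (h *> x) => //.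
  by rewrite -[X in X _]Hx; exists h.
rewrite -{1}Hy => -[k]; rewrite -{1}Hx => -[l Hl <- <-].
by exists l; rewrite ?ractM.
Qed.

Lemma StabV x : Stab T H x ->
  exists2 y, Stab T H y & forall h, H h -> h *> x *> y = h /\ h *> y *> x = h.
Proof.
move=> [Tx Hx]; case: (hH) => h0 HE.
have Hh0 : H h0 by rewrite HE.
have Hact h : H h -> H (h *> x) by move=> Hh; rewrite -[X in X _]Hx; exists h.
have HrelH h : H h -> relH T h0 h by rewrite HE.
have [R0 _] := HrelH _ (Hact _ Hh0).
have : [set h0 *> t | t in adj1_set T] h0 by exists 1 => //; exact: adj1_set1.
rewrite R0 => -[y Ty h0xy].
have xy h : H h -> h *> x *> y = h.
  move=> /HrelH [_ Lh].
  have : [set t *< h | t in adj1_set T] h by exists 1 => //; exact: adj1_set1.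
  by rewrite -Lh => -[u Tu <-]; rewrite !lract h0xy.
have yx h : H h -> H (h *> y) /\ h *> y *> x = h.
  by rewrite -{1}Hx => -[k Hk <-]; rewrite xy.
exists y; last by move=> h Hh; split; [exact: xy|exact: (yx _ Hh).2].
split=> //; apply/seteqP; split=> [_ [h Hh <-]|h Hh]; first exact: (yx _ Hh).1.
by exists (h *> x); [exact: Hact|exact: xy].
Qed.

Definition stab_one : Stab T H := SigSub (mem_set Stab1).
Definition stab_mul (x y : Stab T H) : Stab T H :=
  SigSub (mem_set (StabM (set_valP x) (set_valP y))).
Definition stab_inv (x : Stab T H) : Stab T H :=
  let e := cid2 (StabV (set_valP x)) in SigSub (mem_set (s2valP e)).

Lemma stab_invP (x : Stab T H) h : H h ->
  h *> val x *> val (stab_inv x) = h /\ h *> val (stab_inv x) *> val x = h.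
Proof. exact: (s2valP' (cid2 (StabV (set_valP x))) h). Qed.

Lemma stab_act (x : Stab T H) h : H h -> H (h *> val x).
Proof. by move=> Hh; have [_ E] := set_valP x; rewrite -[X in X _]E; exists h. Qed.

Definition schutz_one : G := schutz_class stab_one.
Definition schutz_mul (a b : G) : G :=
  schutz_class (stab_mul (repr a) (repr b)).
Definition schutz_inv (a : G) : G := schutz_class (stab_inv (repr a)).

Lemma schutz_repr (a : G) : schutz_class (repr a) = a.
Proof. exact: reprK. Qed.

Lemma schutz_mulE x y :
  schutz_mul (schutz_class x) (schutz_class y) = schutz_class (stab_mul x y).
Proof.
apply/schutz_classP => h Hh /=; rewrite !ractM.
have /schutz_classP -> // := schutz_repr (schutz_class x).
have /schutz_classP -> // := schutz_repr (schutz_class y).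
exact: stab_act.
Qed.

Fact schutz_mulA : associative schutz_mul.
Proof.
move=> a b c; rewrite -(schutz_repr a) -(schutz_repr b) -(schutz_repr c).
by rewrite !schutz_mulE; apply/schutz_classP => h Hh /=; rewrite mulgA.
Qed.

Fact schutz_mul1g : left_id schutz_one schutz_mul.
Proof.
move=> a; rewrite -(schutz_repr a) schutz_mulE.
by apply/schutz_classP => h Hh /=; rewrite mul1g.
Qed.

Fact schutz_mulg1 : right_id schutz_one schutz_mul.
Proof.
move=> a; rewrite -(schutz_repr a) schutz_mulE.
by apply/schutz_classP => h Hh /=; rewrite mulg1.
Qed.

Fact schutz_mulVg : left_inverse schutz_one schutz_inv schutz_mul.
Proof.
move=> a; rewrite -[X in schutz_mul _ X]schutz_repr schutz_mulE.
by apply/schutz_classP => h Hh; rewrite ractM; exact: (stab_invP _ Hh).2.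
Qed.

Fact schutz_mulgV : right_inverse schutz_one schutz_inv schutz_mul.
Proof.
move=> a; rewrite -[X in schutz_mul X _]schutz_repr schutz_mulE.
by apply/schutz_classP => h Hh; rewrite ractM; exact: (stab_invP _ Hh).1.
Qed.

HB.instance Definition _ := isGroup.Build G
  schutz_mulA schutz_mul1g schutz_mulg1 schutz_mulVg schutz_mulgV.

Lemma schutz_classM (x y : Stab T H) :
  schutz_class x * schutz_class y = schutz_class (stab_mul x y).
Proof. exact: schutz_mulE. Qed.

End SchutzGroup.

(* The action on Lambda + {0}, with None as 0; mu is unique because the
   indexing H_ is injective wherever this is used. *)
Definition lam_act (S : semigroupType) (Lambda : Type) (H_ : Lambda -> set S)
    (l : option Lambda) (t : adj1 S) : option Lambda :=
  if l is Some l0 then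
    if pselect (exists m, [set h *> t | h in H_ l0] = H_ m) is left e
    then Some (projT1 (cid e)) else None
  else None.

(* The set X. The witness s records that p_l b p'_m lies in Stab(H), so that
   its gamma-class is an element of Gamma(H). *)
Definition schutz_gens (S : semigroupType) (T H : set S)
    (hT : mulg_closed [in T]) (hH : is_Hclass T H) (B : set S)
    (Lambda : Type) (H_ : Lambda -> set S) (p p' : Lambda -> adj1 S) :
    set (Schutz hT hH) :=
  [set g | exists l b m (s : Stab T H),
     [/\ B b, lam_act H_ (Some l) (inS b) = Some m,
         val s = p l * inS b * p' m & g = schutz_class hT hH s]].
Arguments schutz_gens {S T H} hT hH B {Lambda} H_ p p' _.

(* Main.v *)
Require Import Defs.
From mathcomp Require Import all_boot all_classical.

Set Implicit Arguments.
Unset Strict Implicit.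
Unset Printing Implicit Defensive.

(** This is Schreier's argument, with the relative H-classes inside the
    relative R-class of [H] in the role of cosets, [p l] in the role of the
    coset representatives, and [p l * b * p' m] in the role of the Schreier
    generators.

    If [H_ l] times [t] is [H_ m] with [t] in T^1, then [p l * t * p' m]
    carries [H] to [H_ l], then to [H_ m], then back to [H], so it stabilizes
    [H] ([transition_Stab]).  When [t] is a product [u * v], Green's lemma
    ([Hclass_translate]) shows that the intermediate set [H_ l u] is itself some
    [H_ k] ([transition_split]).  Inserting [p' k * p k], which acts trivially
    on [H_ k], shows that [p l * (u * v) * p' m] and
    [(p l * u * p' k) * (p k * v * p' m)] act identically on [H], hence
    have the same class in the Schutzenberger group.  So the elements of [T] all
    of whose transitions have their class in a given subgroup form a
    subsemigroup ([transition_in_subgroup]); if the subgroup contains [X], this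
    subsemigroup contains [B] and is all of [T].  An element of the stabilizer
    of [H] is its own transition from [H] to [H], because [p l1 = p' l1 = 1].

    For finite generation, each pair of an H-class and an element of [B] yields
    at most one element of [X] ([finite_schutz_gens]). *)

Local Open Scope classical_set_scope.
Local Open Scope group_scope.

(** * Relative Green relations *)

Section Green.
Variables (S : semigroupType) (T : set S).
Hypothesis hT : mulg_closed [in T].
Implicit Types (u v w : S) (s t : adj1 S) (K : set S).

Lemma relR_ractP u v : relR T u v -> exists2 t, adj1_set T t & u *> t = v.
Proof.
move=> uv; have : [set v *> t | t in adj1_set T] v by exists 1 => //; left.
by rewrite -uv => -[t Tt <-]; exists t.
Qed.

Lemma relL_lactP u v : relL T u v -> exists2 t, adj1_set T t & t *< u = v.
Proof.
move=> uv; have : [set t *< v | t in adj1_set T] v by exists 1 => //; left.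
by rewrite -uv => -[t Tt <-]; exists t.
Qed.

Lemma ract_relR u s t : adj1_set T s -> adj1_set T t ->
  u *> s *> t = u -> relR T u (u *> s).
Proof.
move=> Ts Tt ust; apply/seteqP; split=> _ [r Tr <-].
- exists (t * r); first exact: adj1_setM.
  by rewrite ractM ust.
- exists (s * r); first exact: adj1_setM.
  by rewrite ractM.
Qed.

Lemma relL_ract u v t : relL T u v -> relL T (u *> t) (v *> t).
Proof.
move=> uv; apply/seteqP; split=> _ [r Tr <-]; rewrite -lract.
- have : [set s *< v | s in adj1_set T] (r *< u) by rewrite -uv; exists r.
  by move=> [s Ts <-]; exists s; rewrite // lract.
- have : [set s *< u | s in adj1_set T] (r *< v) by rewrite uv; exists r.
  by move=> [s Ts <-]; exists s; rewrite // lract.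
Qed.

Lemma Hclass_relH K u v : is_Hclass T K -> K u -> K v -> relH T u v.
Proof.
move=> [h ->] [Ru Lu] [Rv Lv].
by split; [rewrite /relR -Ru|rewrite /relL -Lu].
Qed.

(** Green's lemma: since the elements of [K] are left multiples of [k], the
    equation [k s t = k] holds with any of them in place of [k], so
    multiplication by [t] inverts multiplication by [s] on [K]. *)
Lemma Hclass_translate K k s t : is_Hclass T K -> K k ->
  adj1_set T s -> adj1_set T t -> k *> s *> t = k ->
  is_Hclass T [set h *> s | h in K].
Proof.
move=> HK Kk Ts Tt kst; exists (k *> s).
have id_left w : relL T k w -> w *> s *> t = w.
  by move=> /relL_lactP [r _ <-]; rewrite !lract kst.
apply/seteqP; split=> [_ [h Kh <-]|z [Rz Lz]].
  have [Rkh Lkh] := Hclass_relH HK Kk Kh.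
  split; last exact: relL_ract.
  rewrite /relR -(ract_relR Ts Tt kst) Rkh.
  exact: (ract_relR Ts Tt (id_left _ Lkh)).
have [r Tr rz] := relL_lactP Lz.
have zts : z *> t *> s = z by rewrite -rz !lract kst.
exists (z *> t) => //.
have Rk : relR T k (z *> t).
  by rewrite /relR (ract_relR Ts Tt kst) Rz; exact: ract_relR zts.
have Lk : relL T k (z *> t) by rewrite -{1}kst; exact: relL_ract.
by move: HK Kk => [h ->] [Rh Lh]; split; rewrite /relR /relL ?Rh ?Lh.
Qed.

End Green.

Lemma group_closed_mul (G : groupType) (A : set G) (x y : G) :
  group_closed [in A] -> A x -> A y -> A (x * y).
Proof.
move=> [A1 Adiv] Ax Ay.
have AV : y^-1 \in A by rewrite -[y^-1]mul1g; apply: Adiv; rewrite // inE.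
by apply/set_mem; rewrite -[y]invgK; apply: Adiv; rewrite // inE.
Qed.

(** * Schreier transitions between the H-classes of an R-class *)

Section Transitions.
Variables (S : semigroupType) (T : set S) (hT : mulg_closed [in T]).
Variables (H : set S) (hH : is_Hclass T H) (Lambda : Type) (H_ : Lambda -> set S).
Hypotheses (H_inj : injective H_) (H_range : range H_ = Hclasses_in_Rclass T H).
Variables (p p' : Lambda -> adj1 S).
Hypotheses (pT : forall l, adj1_set T (p l)) (p'T : forall l, adj1_set T (p' l)).
Hypothesis Hp : forall l, [set h *> p l | h in H] = H_ l.
Hypothesis pp' : forall l h, H h -> h *> p l *> p' l = h.
Hypothesis p'p : forall l h, H_ l h -> h *> p' l *> p l = h.
Implicit Types (l m : Lambda) (t : adj1 S) (B : set S).

Let moves l t m := [set h *> t | h in H_ l] = H_ m.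

Lemma H_nonempty l : exists h, H_ l h.
Proof.
by case: hH => h HE; exists (h *> p l); rewrite -Hp; exists h; rewrite // HE.
Qed.

Lemma lam_actP l t m : lam_act H_ (Some l) t = Some m <-> moves l t m.
Proof.
rewrite /lam_act /moves; split.
  by case: pselect => // e [<-]; case: (cid e).
move=> E; case: pselect => [e|[]]; last by exists m.
by congr Some; apply: H_inj; case: (cid e) => /= k <-.
Qed.

Lemma transition_Stab l t m : adj1_set T t -> moves l t m ->
  Stab T H (p l * t * p' m).
Proof.
move=> Tt E; split; first by apply: adj1_setM => //; apply: adj1_setM.
apply/seteqP; split=> [_ [h Hh <-]|h Hh].
  have : H_ m (h *> p l *> t).
    by rewrite -E; exists (h *> p l) => //; rewrite -Hp; exists h.
  by rewrite !ractM -Hp => -[k Hk <-]; rewrite pp'.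
have : H_ m (h *> p m) by rewrite -Hp; exists h.
rewrite -E -{1}Hp => -[_ [k Hk <-] kE].
by exists k; rewrite // !ractM kE pp'.
Qed.

(** The H-class [H_ m] lies in the same R-class as [H_ l], so the step by [u]
    from [H_ l] towards [H_ m] can be undone, and Green's lemma applies to it. *)
Lemma transition_split l u v m : adj1_set T u -> adj1_set T v ->
  moves l (u * v) m -> exists2 k, moves l u k & moves k v m.
Proof.
move=> Tu Tv E.
have range_class k : Hclasses_in_Rclass T H (H_ k) by rewrite -H_range; exists k.
have RH k h : H_ k h -> exists2 h0, H h0 & relR T h0 h.
  by have [_ sub] := range_class k => /sub.
have R_all k k1 a b : H_ k a -> H_ k1 b -> relR T a b.
  move=> /RH [c Hc ca] /RH [d Hd db].
  by have [cd _] := Hclass_relH hH Hc Hd; rewrite /relR -ca -db.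
have [a Ka] := H_nonempty l.
have Kauv : H_ m (a *> u *> v) by rewrite -ractM -E; exists a.
have [r Tr ar] := relR_ractP (R_all _ _ _ _ Kauv Ka).
have Tvr : adj1_set T (v * r) by exact: adj1_setM.
have aK : a *> u *> (v * r) = a by rewrite ractM ar.
have HcK : is_Hclass T [set h *> u | h in H_ l].
  exact: Hclass_translate (range_class l).1 Ka Tu Tvr aK.
have : range H_ [set h *> u | h in H_ l].
  rewrite H_range; split=> // _ [h Kh <-].
  have [h0 Hh0 h0h] := RH _ _ Kh; exists h0 => //.
  have [Rc _] : relH T (a *> u) (h *> u).
    by apply: (Hclass_relH HcK); [exists a|exists h].
  rewrite /relR -Rc -(ract_relR hT Tu Tvr aK) h0h.
  exact: R_all Kh Ka.
move=> [k _ kE]; exists k => //.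
rewrite /moves -E kE; apply/seteqP; split=> [_ [_ [h Kh <-] <-]|_ [h Kh <-]].
  by exists h; rewrite // ractM.
by exists (h *> u); [exists h|rewrite ractM].
Qed.

(** Induction over [T]: transitions multiply because [p' k * p k] acts as the
    identity on [H_ k]. *)
Lemma transition_in_subgroup B (A : set (Schutz hT hH)) :
  T = semigroup_closure B ->
  group_closed [in A] -> schutz_gens hT hH B H_ p p' `<=` A ->
  forall w, T w -> forall l m (s : Stab T H), moves l (inS w) m ->
    val s = p l * inS w * p' m -> A (schutz_class hT hH s).
Proof.
move=> TB Agrp genA.
pose good := [set w | T w /\ forall l m (s : Stab T H), moves l (inS w) m ->
    val s = p l * inS w * p' m -> A (schutz_class hT hH s)].
suff sub : T `<=` good by move=> w /sub [].
rewrite {1}TB; apply: smallest_sub => [u v|b Bb].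
  move=> /set_mem [Tu gu] /set_mem [Tv gv]; apply/mem_set; split.
    by apply/set_mem/hT; apply/mem_set.
  move=> l m s E sE.
  have Tu1 : adj1_set T (inS u) by right; exists u.
  have Tv1 : adj1_set T (inS v) by right; exists v.
  have [k luk kvm] := transition_split Tu1 Tv1 E.
  pose x : Stab T H := SigSub (mem_set (transition_Stab Tu1 luk)).
  pose y : Stab T H := SigSub (mem_set (transition_Stab Tv1 kvm)).
  have -> : schutz_class hT hH s = schutz_class hT hH x * schutz_class hT hH y.
    rewrite schutz_classM; apply/schutz_classP => h Hh.
    have Kk : H_ k (h *> p l *> inS u).
      by rewrite -luk; exists (h *> p l) => //; rewrite -Hp; exists h.
    rewrite sE /= !ractM (p'p Kk); congr (_ *> _).
    exact: (ractM _ (inS u) (inS v)).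
  by apply: group_closed_mul => //; [exact: (gu l k x)|exact: (gv k m y)].
have Tb : T b by rewrite TB; exact: sub_gen_smallest.
split=> // l m s E sE; apply: genA.
by exists l, b, m, s; split=> //; exact/lam_actP.
Qed.

Lemma schutz_gens_generate B l1 : T = semigroup_closure B ->
  H_ l1 = H -> p l1 = 1 -> p' l1 = 1 ->
  group_closure (schutz_gens hT hH B H_ p p') = [set: Schutz hT hH].
Proof.
move=> TB Hl1 pl1 p'l1; apply/seteqP; split=> // g _ A [Agrp genA].
rewrite -(schutz_repr g); case: (set_valP (repr g)) => -[E|[w Tw E]] st.
  have -> : schutz_class hT hH (repr g) = 1.
    by apply/schutz_classP => h Hh; rewrite E.
  by have [/set_mem] := Agrp.
apply: (transition_in_subgroup TB Agrp genA Tw (l := l1) (m := l1)).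
  by rewrite /moves Hl1 -E.
by rewrite pl1 p'l1 mul1g mulg1.
Qed.

(** The generators are grouped by H-class rather than by index: it is the set
    of H-classes that is known to be finite. *)
Lemma finite_schutz_gens B : finite_set B ->
  finite_set (Hclasses_in_Rclass T H) ->
  finite_set (schutz_gens hT hH B H_ p p').
Proof.
move=> finB finH.
pose fibre K b := [set g : Schutz hT hH | exists l m (s : Stab T H),
  [/\ H_ l = K, moves l (inS b) m, val s = p l * inS b * p' m &
      g = schutz_class hT hH s]].
apply: (@sub_finite_set _ _
    (\bigcup_(K in Hclasses_in_Rclass T H) \bigcup_(b in B) fibre K b)).
  move=> g [l [b [m [s [Bb /lam_actP E sE gE]]]]].
  exists (H_ l); first by rewrite -H_range; exists l.
  by exists b => //; exists l, m, s.
apply: bigcup_finite => // K _; apply: bigcup_finite => // b _.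
have [[g Fg]|F0] := pselect (exists g, fibre K b g); last first.
  by apply: sub_finite_set (finite_set0 _) => g Fg; case: F0; exists g.
apply: sub_finite_set (finite_set1 g) => g' /=.
move: Fg => [l [m [s [lK E sE ->]]]] [l' [m' [s' [l'K E' s'E ->]]]].
have ll : l' = l by apply: H_inj; rewrite lK.
have mm : m' = m by apply: H_inj; rewrite -E -E' ll.
by apply/schutz_classP => h _; rewrite sE s'E ll mm.
Qed.

End Transitions.

Theorem theorem5p1 (S : semigroupType) (T : set S)
  (hT : mulg_closed [in T])
  (B : set S) (hB : T = semigroup_closure B)
  (H : set S) (hH : is_Hclass T H)
  (Lambda : Type) (H_ : Lambda -> set S)
  (H_inj : injective H_)
  (H_range : range H_ = Hclasses_in_Rclass T H)
  (p p' : Lambda -> adj1 S)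
  (pT : forall l, adj1_set T (p l))
  (p'T : forall l, adj1_set T (p' l))
  (Hp : forall l, [set h *> p l | h in H] = H_ l)
  (pp' : forall l h, H h -> h *> p l *> p' l = h)
  (p'p : forall l h, H_ l h -> h *> p' l *> p l = h)
  (l1 : Lambda) (Hl1 : H_ l1 = H) (pl1 : p l1 = 1) (p'l1 : p' l1 = 1) :
  [/\ forall l b m, B b -> lam_act H_ (Some l) (inS b) = Some m ->
        Stab T H (p l * inS b * p' m),
      group_closure (schutz_gens hT hH B H_ p p') = [set: Schutz hT hH]
    & (exists2 B0 : set S, finite_set B0 & T = semigroup_closure B0) ->
      finite_set (Hclasses_in_Rclass T H) ->
      exists2 Y : set (Schutz hT hH), finite_set Y &
        group_closure Y = [set: Schutz hT hH]].
Proof.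
split.
- move=> l b m Bb /(lam_actP H_inj) E.
  apply: (transition_Stab hT pT p'T Hp pp' _ E).
  by right; exists b; rewrite // hB; exact: sub_gen_smallest.
- exact: schutz_gens_generate Hl1 pl1 p'l1.
- move=> [B0 finB0 TB0] finH; exists (schutz_gens hT hH B0 H_ p p').
    exact: finite_schutz_gens.
  exact: schutz_gens_generate Hl1 pl1 p'l1.
Qed.
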